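(* Let $A\in\mathbb{R}^{n\times n}$ be passive, $B\in\mathbb{R}^{n\times q}$, $C\in\mathbb{R}^{p\times n}$, $x_0\in\mathbb{C}^n$, and let $V_k\in\mathbb{R}^{n\times d_k}$ have orthonormal columns. Put $T_k=V_k^*AV_k$, $B_k=V_k^*B$, $C_k=CV_k$. Let $Y_k\ge 0$ be the solution of the reduced Riccati equation $T_k^*Y+YT_k-YB_kB_k^*Y+C_k^*C_k=0$ obtained by Galerkin projection. Then $Y_k$ is the unique positive semidefinite solution of this equation, and it gives the feedback optimal control for the reduced system $$\dot{\widehat x}(t)=T_k\widehat x(t)+B_k\widehat u(t),\qquad \widehat x(0)=\widehat x_0:=V_k^*x_0,\qquad \widehat y(t)=C_k\widehat x(t),$$ that is, the infimum over $\widehat u$ of $\widehat{\mathcal{J}}_k(\widehat u,\widehat x_0)=\int_0^\infty(\widehat x(t)^*C_k^*C_k\widehat x(t)+\widehat u(t)^*\widehat u(t))\,dt$ is attained at $\widehat u_*(t)=-B_k^*Y_k\widehat x(t)=-B_k^*Y_k\exp((T_k-B_kB_k^*Y_k)t)\,\widehat x_0$, $t\ge0$.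
   Context: $M^*$ denotes the conjugate transpose. $Y\ge0$ means symmetric positive semidefinite. A matrix is stable if all its eigenvalues lie in the open left half complex plane; $A$ is passive if its field of values $\{x^*Ax/(x^*x): 0\ne x\in\mathbb{C}^n\}$ lies in the open left half plane; if $A$ is passive then $T_k$ is stable. $Y_k$ is the stabilizing solution, i.e. $T_k-B_kB_k^*Y_k$ is stable. Control functions $\widehat u$ are taken measurable and locally square integrable on $[0,\infty)$, and $\widehat x$ denotes the corresponding state trajectory in $\widehat{\mathcal{J}}_k$. *)

(* Defs.v *)
From HB Require Import structures.
From mathcomp Require Import all_boot all_order all_algebra.
From mathcomp Require Import complex.
From mathcomp Require Import all_classical all_reals all_analysis.

Set Implicit Arguments.
Unset Strict Implicit.
Unset Printing Implicit Defensive.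

Import Order.TTheory GRing.Theory Num.Theory.
Import numFieldNormedType.Exports.

Local Open Scope classical_set_scope.
Local Open Scope ring_scope.
Local Open Scope sesquilinear_scope.

(* For a real matrix the conjugate transpose is M^T; M ^t* is used for complex
   matrices and vectors. *)
Definition cmx (R : realType) (m n : nat) (M : 'M[R]_(m, n)) : 'M[R[i]]_(m, n) :=
  map_mx (real_complex R) M.

Definition stable (R : realType) (n : nat) (M : 'M[R]_n) : Prop :=
  forall z : R[i], eigenvalue (cmx M) z -> complex.Re z < 0.

Definition field_of_values (R : realType) (n : nat) (A : 'M[R]_n) : set R[i] :=
  [set z | exists2 x : 'cV[R[i]]_n, x != 0 &
     z = (x ^t* *m cmx A *m x) 0 0 / (x ^t* *m x) 0 0].

Definition passive (R : realType) (n : nat) (A : 'M[R]_n) : Prop :=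
  forall z : R[i], field_of_values A z -> complex.Re z < 0.

Definition psd (R : realType) (n : nat) (Y : 'M[R]_n) : Prop :=
  Y^T = Y /\ forall x : 'cV[R]_n, 0 <= (x^T *m Y *m x) 0 0.

Definition riccati (R : realType) (n q p : nat) (T : 'M[R]_n) (B : 'M[R]_(n, q))
    (C : 'M[R]_(p, n)) (Y : 'M[R]_n) : 'M[R]_n :=
  T^T *m Y + Y *m T - Y *m B *m B^T *m Y + C^T *m C.

(* The limit of the exponential series is taken entry by entry, which agrees
   with the limit in any matrix norm. *)
Definition expmx (R : realType) (n : nat) (M : 'M[R]_n) : 'M[R]_n :=
  \matrix_(i, j) limn (series (fun k : nat => (k`!%:R^-1 *: M ^+ k) i j)).

Definition vmeasurable (R : realType) (n : nat) (D : set R)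
    (f : R -> 'cV[R[i]]_n) : Prop :=
  forall i, measurable_fun D (fun t => complex.Re (f t i 0)) /\
            measurable_fun D (fun t => complex.Im (f t i 0)).

Definition vintegrable (R : realType) (n : nat) (D : set R)
    (f : R -> 'cV[R[i]]_n) : Prop :=
  forall i,
    (@lebesgue_measure R).-integrable D (fun t => (complex.Re (f t i 0))%:E) /\
    (@lebesgue_measure R).-integrable D (fun t => (complex.Im (f t i 0))%:E).

Definition vintegral (R : realType) (n : nat) (D : set R)
    (f : R -> 'cV[R[i]]_n) : 'cV[R[i]]_n :=
  \col_i Complex
    (Rintegral (@lebesgue_measure R) D (fun t => complex.Re (f t i 0)))
    (Rintegral (@lebesgue_measure R) D (fun t => complex.Im (f t i 0))).

(* Controls and trajectories are functions on the whole line of which only the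
   values on [0, +oo[ are ever used. *)
Definition admissible (R : realType) (q : nat) (u : R -> 'cV[R[i]]_q) : Prop :=
  vmeasurable `[0, +oo[ u /\
  forall t : R, 0 <= t ->
    (\int[@lebesgue_measure R]_(s in `[0%R, t])
       (complex.Re (((u s) ^t* *m u s) 0 0))%:E < +oo)%E.

(* x' = T x + B u, x(0) = x0 in the Caratheodory sense: the control is only
   locally square integrable, so a solution is a locally absolutely continuous
   function satisfying the equation almost everywhere, i.e. the indefinite
   integral of its right-hand side started at x0. *)
Definition trajectory (R : realType) (n q : nat) (T : 'M[R]_n)
    (B : 'M[R]_(n, q)) (x0 : 'cV[R[i]]_n) (u : R -> 'cV[R[i]]_q)
    (x : R -> 'cV[R[i]]_n) : Prop :=
  let rhs := fun s => cmx T *m x s + cmx B *m u s in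
  forall t : R, 0 <= t ->
    vintegrable `[0, t] rhs /\ x t = x0 + vintegral `[0, t] rhs.

(* The integrand is a nonnegative real number; the integral may be +oo. *)
Definition cost (R : realType) (n q p : nat) (C : 'M[R]_(p, n))
    (u : R -> 'cV[R[i]]_q) (x : R -> 'cV[R[i]]_n) : \bar R :=
  (\int[@lebesgue_measure R]_(t in `[0%R, +oo[)
     (complex.Re (((x t) ^t* *m (cmx C) ^t* *m cmx C *m x t
                   + (u t) ^t* *m u t) 0 0))%:E)%E.

Definition costs (R : realType) (n q p : nat) (T : 'M[R]_n)
    (B : 'M[R]_(n, q)) (C : 'M[R]_(p, n)) (x0 : 'cV[R[i]]_n) : set (\bar R) :=
  [set J | exists u x, [/\ admissible u, trajectory T B x0 u x & J = cost C u x]].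

(* Main.v *)
(* For a locally absolutely continuous x with x' = f and a symmetric P, the
   function x^T P x is the indefinite integral of 2 x^T P f; for merely
   integrable f this product rule is Fubini's theorem on a triangle.  Along a
   trajectory x' = T x + B u the Riccati equation gives
     2 x^T Y (T x + B u) = |u + B^T Y x|^2 - (|C x|^2 + |u|^2),
   so the cost up to time t is at least x0^T Y x0 - x(t)^T Y x(t), with equality
   for the feedback u = - B^T Y x.  If some control had a cost below x0^T Y x0,
   then x(t)^T Y x(t), hence |x(t)|^2, would stay away from 0; but T is negative
   definite by passivity, so |x|^2 has derivative at most - a |x|^2 + K |u|^2 and
   would become negative.  Thus x0^T Y x0 is the optimal value for every positive
   semidefinite solution Y, which also gives uniqueness. *)

Require Import Defs.
From mathcomp Require Import all_boot all_order all_algebra.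
From mathcomp Require Import complex.
From mathcomp Require Import all_classical all_reals all_analysis.
From mathcomp Require Import measurable_realfun.
From mathcomp Require Import ring lra.

Set Implicit Arguments.
Unset Strict Implicit.
Unset Printing Implicit Defensive.

Import Order.TTheory GRing.Theory Num.Theory.
Import numFieldNormedType.Exports.

Local Open Scope classical_set_scope.
Local Open Scope ring_scope.

(** * Indefinite Lebesgue integrals *)

Section IndefiniteIntegral.
Variable R : realType.
Implicit Types (f g x y : R -> R) (J : set R) (t : R).
Local Notation mu := (@lebesgue_measure R).

(** The integral form of: [x] is locally absolutely continuous on the half-line, starts at [x0] and
    has derivative [f] almost everywhere. Integrability is part of it because a real-valued integral
    is a default value without it. *)
Definition primitive (x0 : R) f x :=
  forall t, 0 <= t -> mu.-integrable `[0, t] (EFin \o f) /\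
    x t = x0 + \int[mu]_(s in `[0, t]) f s.

Lemma mem_itvcc (a b s : R) : (s \in `[a, b]%classic) = (a <= s <= b).
Proof. by rewrite mem_setE in_itv. Qed.

Lemma integrable_patch g J : measurable J -> mu.-integrable J (EFin \o g) ->
  mu.-integrable setT (EFin \o (g \_ J)).
Proof.
move=> mJ ig; rewrite -restrict_EFin; apply/integrable_restrict => //.
by rewrite setTI.
Qed.

Lemma EFin_mulr_Rintegral c g J : measurable J -> mu.-integrable J (EFin \o g) ->
  (c * \int[mu]_(r in J) g r)%:E = (\int[mu]_r (c * (g \_ J) r)%:E)%E.
Proof.
move=> mJ ig.
have igJ : mu.-integrable setT (EFin \o (g \_ J)).
  exact: integrable_patch.
under eq_integral do rewrite EFinM.
rewrite integralZl// EFinM; congr (_ * _)%E.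
rewrite Rintegral_mkcond /Rintegral fineK//.
exact: integrable_fin_num.
Qed.

(** Tonelli: the absolute value is dominated by [|f s| * |g r|], whose iterated integral is a
    product of two finite norms. *)
Lemma integrable_triangle f g : mu.-integrable setT (EFin \o f) ->
  mu.-integrable setT (EFin \o g) ->
  (mu \x mu)%E.-integrable setT
    (fun z : R * R => (if z.2 <= z.1 then f z.1 * g z.2 else 0)%:E).
Proof.
move=> fi gi.
have mf : measurable_fun setT f by apply/measurable_EFinP; apply: (measurable_int mu).
have mg : measurable_fun setT g by apply/measurable_EFinP; apply: (measurable_int mu).
have mh : measurable_fun setT
    (fun z : R * R => (if z.2 <= z.1 then f z.1 * g z.2 else 0)%:E).
  apply/measurable_EFinP/measurable_fun_ifT => //.
    exact: measurable_fun_ler.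
  by apply: measurable_funM; [exact: measurableT_comp mf _|exact: measurableT_comp mg _].
apply/integrable12ltyP => //=.
have /integrableP[_ fy] := fi.
have /integrableP[_ gy] := gi.
apply: (@le_lt_trans _ _ (\int[mu]_s (`|(f s)%:E| * \int[mu]_r `|(g r)%:E|))%E).
  apply: ge0_le_integral => //.
  - by move=> s _; apply: integral_ge0.
  - apply: (@measurable_fun_fubini_tonelli_F _ _ _ _ _ mu
      (abse \o (fun z : R * R => (if z.2 <= z.1 then f z.1 * g z.2 else 0)%:E))) => //=.
    exact: measurableT_comp.
  - apply: emeasurable_funM => //.
    by apply: measurableT_comp => //; apply/measurable_EFinP.
  move=> s _; rewrite -ge0_integralZl//; last first.
    by apply: measurableT_comp => //; apply/measurable_EFinP.
  apply: ge0_le_integral => //.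
  - apply/measurable_EFinP; apply: measurableT_comp => //.
    apply: measurable_fun_ifT => //; first exact: measurable_fun_ler.
    exact: measurable_funM.
  - apply: emeasurable_funM => //.
    by apply: measurableT_comp => //; apply/measurable_EFinP.
  move=> r _; case: ifP => _; first by rewrite normrM EFinM.
  by rewrite normr0 mule_ge0.
rewrite ge0_integralZr//; last by apply: integral_ge0.
  by rewrite lte_mul_pinfty// ?integral_ge0// ge0_fin_numE// ?integral_ge0.
by apply: measurableT_comp => //; apply/measurable_EFinP.
Qed.

(* Both sides are the integral of f s * g r over the triangle r <= s. *)
Lemma Rintegral_triangle t f g : mu.-integrable `[0, t] (EFin \o f) ->
  mu.-integrable `[0, t] (EFin \o g) ->
  \int[mu]_(s in `[0, t]) (f s * \int[mu]_(r in `[0, s]) g r) =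
  \int[mu]_(r in `[0, t]) (g r * \int[mu]_(s in `[r, t]) f s).
Proof.
move=> fi gi; set I := `[0, t]%classic in fi gi *.
have mI : measurable I by exact: measurable_itv.
have fI : mu.-integrable setT (EFin \o (f \_ I)).
  exact: integrable_patch.
have gI : mu.-integrable setT (EFin \o (g \_ I)).
  exact: integrable_patch.
have /= E := Fubini (integrable_triangle fI gI).
rewrite Rintegral_mkcond [RHS]Rintegral_mkcond; congr fine.
(* Extending by zero turns the moving bound of the inner integral into the condition [r <= s] on the
   whole plane, where Fubini applies. *)
rewrite [LHS](_ : _ = (\int[mu]_s \int[mu]_r
    (if r <= s then (f \_ I) s * (g \_ I) r else 0)%:E)%E); last first.
  apply: eq_integral => s _; rewrite patchE; case: ifPn => sI; last first.
    by rewrite integral0_eq// => r _; rewrite patchE (negbTE sI) mul0r if_same.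
  have /andP[s0 st] : 0 <= s <= t by rewrite -mem_itvcc.
  rewrite -/(Rintegral mu `[0, s] g) EFin_mulr_Rintegral//; last first.
    by apply: integrableS gi => //; apply: subset_itvl; rewrite bnd_simp.
  apply: eq_integral => r _; rewrite !patchE sI; congr EFin.
  have [rs|sr] := leP r s.
    by rewrite /I !mem_itvcc rs (le_trans rs st) !andbT.
  by rewrite mem_itvcc [r <= s]leNgt sr andbF mulr0.
rewrite E; apply: eq_integral => r _; rewrite patchE; case: ifPn => rI; last first.
  rewrite integral0_eq// => s _.
  by rewrite patchE [X in _ * X]patchE (negbTE rI) mulr0 if_same.
have /andP[r0 rt] : 0 <= r <= t by rewrite -mem_itvcc.
rewrite -/(Rintegral mu `[r, t] f) EFin_mulr_Rintegral//; last first.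
  by apply: integrableS fi => //; apply: subset_itvr; rewrite bnd_simp.
apply: eq_integral => s _; rewrite !patchE rI mulrC; congr EFin.
have [rs|sr] := leP r s.
  by rewrite /I !mem_itvcc rs (le_trans r0 rs).
by rewrite mem_itvcc [r <= s]leNgt sr mulr0.
Qed.

(** Continuity is only within [[0, t]]: [primitive] says nothing of [x] at negative times. *)
Lemma primitive_continuous (x0 : R) f x t : primitive x0 f x -> 0 <= t ->
  {within `[0, t], continuous x}.
Proof.
move=> xf t0; have [fi _] := xf _ t0.
have H := parameterized_integral_continuous t0 fi.
apply: (subspace_eq_continuous (f := cst x0 + (fun s => \int[mu]_(r in `[0, s]) f r))).
  move=> s; rewrite inE /= in_itv/= => /andP[s0 _].
  by rewrite /from_subspace; have [_ ->] := xf _ s0.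
by apply: within_continuousD => //; apply: continuous_subspaceT => ?; exact: cvg_cst.
Qed.

Lemma continuous_itv_bounded (x : R -> R) t : {within `[0, t], continuous x} ->
  [bounded x s | s in `[0, t]].
Proof.
move=> cx; have := compact_bounded (continuous_compact cx (@segment_compact _ 0 t)).
move=> [M [Mr HM]]; exists M; split => // N MN s /= sI.
by apply: (HM _ MN); exists s.
Qed.

Lemma continuous_itv_measurable (x : R -> R) t : {within `[0, t], continuous x} ->
  measurable_fun `[0, t] x.
Proof. by move=> cx; exact: subspace_continuous_measurable_fun. Qed.

Lemma integrableM_continuous t f x : {within `[0, t], continuous x} ->
  mu.-integrable `[0, t] (EFin \o f) ->
  mu.-integrable `[0, t] (EFin \o (fun s => f s * x s)).
Proof.
move=> cx fi.
rewrite (_ : _ \o _ = (EFin \o f) \* (EFin \o x))%E; last first.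
  by apply/funext => s /=; rewrite EFinM.
apply: integrableMl => //; first exact: continuous_itv_measurable.
exact: continuous_itv_bounded.
Qed.

(** Integration by parts for derivatives that are merely integrable, through
    [Rintegral_triangle]. *)
Lemma primitive_mul (x0 y0 : R) f g x y : primitive x0 f x -> primitive y0 g y ->
  primitive (x0 * y0) (fun s => f s * y s + g s * x s) (fun s => x s * y s).
Proof.
move=> xf yg t t0.
have cx := primitive_continuous xf t0.
have cy := primitive_continuous yg t0.
have [fi xt] := xf _ t0.
have [gi yt] := yg _ t0.
have fyi := integrableM_continuous cy fi.
have gxi := integrableM_continuous cx gi.
split.
  by apply: (eq_integrable _ _ _ _ (integrableD _ fyi gxi)) => // s _ /=; rewrite EFinD.
rewrite RintegralD//.
(* Replacing [y s] by [y0] plus the integral of [g] leaves an integral over the triangle. *)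
have -> : \int[mu]_(s in `[0, t]) (f s * y s) =
   (x t - x0) * y0 + \int[mu]_(s in `[0, t]) (f s * \int[mu]_(r in `[0, s]) g r).
  rewrite xt addrAC subrr add0r -RintegralZr// -RintegralD//.
  - apply: eq_Rintegral => s; rewrite inE /= in_itv/= => /andP[s0 _].
    by have [_ ->] := yg _ s0; rewrite mulrDr.
  - exact: integrableZr fi.
  - by apply: integrableM_continuous => //; exact: parameterized_integral_continuous.
rewrite Rintegral_triangle//.
rewrite -addrA -RintegralD//; last first.
  suff h : mu.-integrable `[0, t] (EFin \o (fun s => g s * (x t - x s))).
    apply: (eq_integrable _ _ _ _ h) => // s.
    rewrite inE /= in_itv/= => /andP[s0 st]; congr (_ * _)%:E.
    rewrite xt; have [_ ->] := xf _ s0.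
    rewrite opprD addrACA subrr add0r Rintegral_itvB ?bnd_simp//.
    rewrite Rintegral_itv_obnd_cbnd//.
    apply: integrableS fi => //; apply: subset_itvr; by rewrite bnd_simp.
  apply: integrableM_continuous => //; apply: within_continuousB => //.
  by apply: continuous_subspaceT => ?; exact: cvg_cst.
(* After the exchange the inner integral of [f] over [[s, t]] is [x t - x s]; adding [x s] leaves
   the constant factor [x t]. *)
rewrite (_ : \int[mu]_(s in `[0, t]) _ = \int[mu]_(s in `[0, t]) (g s * x t)); last first.
  apply: eq_Rintegral => s; rewrite inE /= in_itv/= => /andP[s0 st].
  rewrite -mulrDr; congr (_ * _).
  rewrite xt; have [_ ->] := xf _ s0.
  rewrite -Rintegral_itv_obnd_cbnd//; last first.
    apply: integrableS fi => //; apply: subset_itvr; by rewrite bnd_simp.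
  rewrite -(Rintegral_itvB fi) ?bnd_simp//.
  by rewrite addrCA subrK.
rewrite RintegralZr// yt; ring.
Qed.

Lemma primitive_scale (c x0 : R) f x : primitive x0 f x ->
  primitive (c * x0) (fun s => c * f s) (fun s => c * x s).
Proof.
move=> xf t t0; have [fi xt] := xf _ t0; split; last by rewrite RintegralZl// -mulrDr -xt.
by apply: (eq_integrable _ _ _ _ (integrableZl _ c fi)) => // s _ /=; rewrite EFinM.
Qed.

Lemma primitive_add (x0 y0 : R) f g x y : primitive x0 f x -> primitive y0 g y ->
  primitive (x0 + y0) (fun s => f s + g s) (fun s => x s + y s).
Proof.
move=> xf yg t t0; have [fi xt] := xf _ t0; have [gi yt] := yg _ t0; split.
  by apply: (eq_integrable _ _ _ _ (integrableD _ fi gi)) => // s _ /=; rewrite EFinD.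
by rewrite RintegralD// xt yt addrACA.
Qed.

Lemma primitive0 : primitive 0 (fun=> 0) (fun=> 0).
Proof.
move=> t t0; split; first exact: integrable0.
by rewrite Rintegral_cst// mul0r addr0.
Qed.

Lemma primitive_sum (I : Type) (r : seq I) (x0 : I -> R) (f x : I -> R -> R) :
  (forall i, primitive (x0 i) (f i) (x i)) ->
  primitive (\sum_(i <- r) x0 i) (fun s => \sum_(i <- r) f i s)
    (fun s => \sum_(i <- r) x i s).
Proof.
move=> xf; elim: r => [|i r IHr].
  rewrite big_nil (_ : (fun s => _) = (fun=> 0)); last first.
    by apply/funext => s; rewrite big_nil.
  by rewrite (_ : (fun s => \sum_(i <- [::]) x i s) = (fun=> 0));
    [exact: primitive0|apply/funext => s; rewrite big_nil].
have := primitive_add (xf i) IHr.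
rewrite big_cons; congr primitive; apply/funext => s; by rewrite big_cons.
Qed.

(** * Nonnegative integrands on the half-line *)

Lemma measurable_fun_itvcy (g : R -> R) :
  (forall t, 0 <= t -> measurable_fun `[0, t] g) -> measurable_fun `[(0 : R), +oo[ g.
Proof.
move=> mg; rewrite itv_bndy_bigcup_BRight; apply/measurable_fun_bigcup => // n.
by rewrite add0r; apply: mg.
Qed.

(** Monotone convergence along the intervals [[0, n]]. *)
Lemma ge0_integral_itvcy_le (g : R -> R) (c : \bar R) :
  (forall s, 0 <= s -> 0 <= g s) -> measurable_fun `[(0 : R), +oo[ g ->
  (forall t, 0 <= t -> (\int[mu]_(s in `[0%R, t]) (g s)%:E <= c)%E) ->
  (\int[mu]_(s in `[0%R, +oo[) (g s)%:E <= c)%E.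
Proof.
move=> g0 mg gc.
rewrite itv_bndy_bigcup_BRight.
have H : (\int[mu]_(s in `[0%R, (0 + n%:R)%R]) (g s)%:E @[n --> \oo] -->
    \int[mu]_(s in \bigcup_n `[0%R, (0 + n%:R)%R]%classic) (g s)%:E)%E.
  apply: ge0_nondecreasing_set_cvg_integral => //.
  - move=> n m nm; apply/subsetPset; apply: subset_itvl.
    by rewrite bnd_simp !add0r ler_nat.
  - move=> n; apply/measurable_EFinP; apply: measurable_funS mg => //.
    exact: subset_itvl.
  - by move=> n s /=; rewrite in_itv/= lee_fin => /andP[s0 _]; exact: g0.
rewrite -(cvg_lim _ H)//; apply: lime_le; first by apply/cvg_ex; eexists; exact: H.
by apply: nearW => n; apply: gc; rewrite add0r.
Qed.

(** Passes from extended to real integrals: [fine] sends [+oo] to 0, so the real bound means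
    something only together with integrability. *)
Lemma Rintegral_le_itvcy (g : R -> R) t c : 0 <= t ->
  (forall s, 0 <= s -> 0 <= g s) -> measurable_fun `[(0 : R), +oo[ g ->
  (\int[mu]_(s in `[0%R, +oo[) (g s)%:E <= c%:E)%E ->
  mu.-integrable `[0, t] (EFin \o g) /\ \int[mu]_(s in `[0, t]) g s <= c.
Proof.
move=> t0 g0 mg gc.
have mgt : measurable_fun `[0, t] g.
  by apply: measurable_funS mg => //; exact: subset_itvl.
have gct : (\int[mu]_(s in `[0%R, t]) (g s)%:E <= c%:E)%E.
  apply: le_trans gc; apply: ge0_subset_integral => //.
  - exact/measurable_EFinP.
  - by move=> s /=; rewrite in_itv/= andbT lee_fin; exact: g0.
  - exact: subset_itvl.
have gi : mu.-integrable `[0, t] (EFin \o g).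
  apply/integrableP; split; first exact/measurable_EFinP.
  rewrite [X in (X < _)%E](_ : _ = \int[mu]_(s in `[0%R, t]) (g s)%:E)%E.
    by rewrite (le_lt_trans gct)// ltry.
  by apply: eq_integral => s; rewrite mem_itvcc => /andP[s0 _] /=; rewrite ger0_norm ?g0.
split => //; rewrite -lee_fin /Rintegral fineK//; exact: integrable_fin_num.
Qed.

End IndefiniteIntegral.

(** * Quadratic forms *)

Section DotProduct.
Variable R : realFieldType.

Definition dot n (x y : 'cV[R]_n) : R := (x^T *m y) 0 0.

Lemma dotE n (x y : 'cV[R]_n) : dot x y = \sum_i x i 0 * y i 0.
Proof. by rewrite /dot mxE; apply: eq_bigr => i _; rewrite mxE. Qed.

Lemma dotC n (x y : 'cV[R]_n) : dot x y = dot y x.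
Proof. by rewrite !dotE; apply: eq_bigr => i _; rewrite mulrC. Qed.

Lemma dotDr n (x y z : 'cV[R]_n) : dot x (y + z) = dot x y + dot x z.
Proof. by rewrite /dot mulmxDr mxE. Qed.

Lemma dotr0 n (x : 'cV[R]_n) : dot x 0 = 0.
Proof. by rewrite /dot mulmx0 mxE. Qed.

Lemma dotNr n (x y : 'cV[R]_n) : dot x (- y) = - dot x y.
Proof. by rewrite /dot mulmxN mxE. Qed.

Lemma dotZr n c (x y : 'cV[R]_n) : dot x (c *: y) = c * dot x y.
Proof. by rewrite /dot -scalemxAr mxE. Qed.

Lemma dotDl n (x y z : 'cV[R]_n) : dot (x + y) z = dot x z + dot y z.
Proof. by rewrite dotC dotDr !(dotC z). Qed.

Lemma dotNl n (x y : 'cV[R]_n) : dot (- x) y = - dot x y.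
Proof. by rewrite dotC dotNr dotC. Qed.

Lemma dotZl n c (x y : 'cV[R]_n) : dot (c *: x) y = c * dot x y.
Proof. by rewrite dotC dotZr dotC. Qed.

Lemma dot_mulmxr m n (P : 'M[R]_(m, n)) x y : dot x (P *m y) = dot (P^T *m x) y.
Proof. by rewrite /dot trmx_mul trmxK mulmxA. Qed.

Lemma dot_mulmxl m n (P : 'M[R]_(m, n)) x y : dot (P *m x) y = dot x (P^T *m y).
Proof. by rewrite dot_mulmxr trmxK. Qed.

Lemma dot_ge0 n (x : 'cV[R]_n) : 0 <= dot x x.
Proof. by rewrite dotE; apply: sumr_ge0 => i _; rewrite -expr2 sqr_ge0. Qed.

Lemma dot_eq0 n (x : 'cV[R]_n) : (dot x x == 0) = (x == 0).
Proof.
rewrite dotE psumr_eq0; last by move=> i _; rewrite -expr2 sqr_ge0.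
apply/idP/eqP => [/allP x0|->]; last by apply/allP => i _; rewrite mxE mul0r eqxx.
apply/colP => i; rewrite mxE; have := x0 i (mem_index_enum i).
by rewrite mulf_eq0 orbb => /eqP.
Qed.

Lemma dot_gt0 n (x : 'cV[R]_n) : x != 0 -> 0 < dot x x.
Proof. by move=> x0; rewrite lt_def dot_ge0 dot_eq0 x0. Qed.

Lemma dot_mulmxE n (P : 'M[R]_n) (x y : 'cV[R]_n) :
  dot x (P *m y) = \sum_i \sum_j P i j * (x i 0 * y j 0).
Proof.
rewrite dotE; apply: eq_bigr => i _; rewrite mxE mulr_sumr.
by apply: eq_bigr => j _; rewrite mulrCA.
Qed.

Lemma quadratic_form_bound n (P : 'M[R]_n) :
  exists2 L, 0 < L & forall x : 'cV[R]_n, dot x (P *m x) <= L * dot x x.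
Proof.
(* The summand 1 keeps the bound positive when [P] is 0, so that it can be divided by. *)
exists (1 + \sum_i \sum_j `|P i j|).
  by rewrite ltr_wpDr ?ltr01//; do 2! apply: sumr_ge0 => ? _.
move=> x; rewrite mulrDl mul1r ler_wpDl ?dot_ge0// dot_mulmxE mulr_suml.
have xi i : x i 0 ^+ 2 <= dot x x.
  rewrite dotE (bigD1 i)//= expr2 lerDl; apply: sumr_ge0 => j _.
  by rewrite -expr2 sqr_ge0.
apply: ler_sum => i _; rewrite mulr_suml; apply: ler_sum => j _.
rewrite (le_trans (ler_norm _))// normrM ler_wpM2l//.
(* [|x i| * |x j|] is at most the mean of the two squares, each bounded by [dot x x]. *)
rewrite normrM; have := xi i; have := xi j.
rewrite -!(real_normK (num_real (x _ 0))).
have := sqr_ge0 (`|x i 0| - `|x j 0|); nra.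
Qed.

(** Polarization: the values at [e i], [e j] and [e i + e j] determine [P i j + P j i], which is
    twice [P i j] by symmetry. *)
Lemma trmx_eq_dot n (P Q : 'M[R]_n) : P^T = P -> Q^T = Q ->
  (forall x : 'cV[R]_n, dot x (P *m x) = dot x (Q *m x)) -> P = Q.
Proof.
move=> PT QT PQ; apply/matrixP => i j.
pose e k : 'cV[R]_n := delta_mx k 0.
have eP (M : 'M[R]_n) k l : dot (e k) (M *m e l) = M k l.
  rewrite dot_mulmxE (bigD1 k)//= (bigD1 l)//= big1 ?addr0; last first.
    by move=> m ml; rewrite !mxE (negbTE ml) /= mulr0 mulr0.
  rewrite big1 ?addr0; first by rewrite !mxE !eqxx !mulr1.
  move=> m mk; rewrite big1// => m' _.
  by rewrite !mxE (negbTE mk) /= mul0r mulr0.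
have symP (M : 'M[R]_n) : M^T = M -> M j i = M i j by move=> {1}<-; rewrite mxE.
have := PQ (e i + e j); rewrite !mulmxDr !dotDr !dotDl !eP.
have := PQ (e i); have := PQ (e j); rewrite !eP.
rewrite (symP _ PT) (symP _ QT); lra.
Qed.

(** The form vanishes at any vector of the kernel. *)
Lemma posdef_unitmx n (S : 'M[R]_n) :
  (forall x : 'cV[R]_n, x != 0 -> 0 < dot x (S *m x)) -> S \in unitmx.
Proof.
move=> Spd; rewrite -unitmx_tr -row_free_unit; apply: inj_row_free => v vS.
apply/eqP/negP => /negP v0.
have : v^T != 0 by apply: contra v0 => /eqP v0; rewrite -(trmxK v) v0 trmx0.
move=> /Spd; rewrite -[S]trmxK -trmx_mul vS trmx0 /dot mulmx0 mxE.
by rewrite ltxx.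
Qed.

(* Completing the square in [(x - 2 S^-1 w)^T S (x - 2 S^-1 w) >= 0]. *)
Lemma posdef_young n (S : 'M[R]_n) (x w : 'cV[R]_n) : S^T = S ->
  (forall x : 'cV[R]_n, x != 0 -> 0 < dot x (S *m x)) ->
  4 * dot x w <= dot x (S *m x) + 4 * dot w (invmx S *m w).
Proof.
move=> ST Spd; have Su := posdef_unitmx Spd.
have Sge (y : 'cV[R]_n) : 0 <= dot y (S *m y).
  have [->|/Spd/ltW//] := eqVneq y 0; by rewrite mulmx0 dotr0.
have := Sge (x - 2 *: (invmx S *m w)).
rewrite mulmxBr -scalemxAr mulKVmx// !dotDr !dotNr !dotZr !dotDl !dotNl !dotZl.
rewrite (dotC (invmx S *m w) (S *m x)) (dot_mulmxl S x) ST mulKVmx//.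
rewrite (dotC (invmx _ *m _)); lra.
Qed.

(** An upper bound [L] for the form of the inverse gives the lower bound [L^-1] for the form of [S],
    without eigenvalues or compactness. *)
Lemma posdef_lower_bound n (S : 'M[R]_n) : S^T = S ->
  (forall x : 'cV[R]_n, x != 0 -> 0 < dot x (S *m x)) ->
  exists2 a, 0 < a & forall x : 'cV[R]_n, a * dot x x <= dot x (S *m x).
Proof.
move=> ST Spd; have [L L0 HL] := quadratic_form_bound (invmx S).
exists (L^-1); first by rewrite invr_gt0.
(* With [w = c *: x] the gain is [4 * c - 4 * c ^+ 2 * L]; it is largest, equal to [L^-1], at
   [c = (2 * L)^-1]. *)
move=> x; have := posdef_young x ((2 * L)^-1 *: x) ST Spd.
rewrite -scalemxAr !dotZr dotZl => H; have := HL x.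
have := HL x => {}HL.
have : 4 * ((2 * L)^-1 * ((2 * L)^-1 * dot x (invmx S *m x))) <= L^-1 * dot x x.
  rewrite (_ : 4 * _ = L^-1 * (L^-1 * dot x (invmx S *m x))); last first.
    by field; rewrite gt_eqF.
  by rewrite ler_pM2l ?invr_gt0// ler_pdivrMl.
move: H; rewrite (_ : 4 * ((2 * L)^-1 * dot x x) = 2 * (L^-1 * dot x x)); last first.
  by field; rewrite gt_eqF.
lra.
Qed.

Lemma negdef_energy n q (T : 'M[R]_n) (B : 'M[R]_(n, q)) :
  (forall x : 'cV[R]_n, x != 0 -> dot x (T *m x) < 0) ->
  exists a K, [/\ 0 < a, 0 < K & forall (x : 'cV[R]_n) (v : 'cV[R]_q),
    2 * dot x (T *m x + B *m v) <= - a * dot x x + K * dot v v].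
Proof.
move=> Tnd; pose S := - (T + T^T).
have ST : S^T = S by rewrite linearN/= linearD/= trmxK addrC.
have SE x : dot x (S *m x) = - 2 * dot x (T *m x).
  rewrite mulNmx dotNr mulmxDl dotDr [dot x (T^T *m x)]dot_mulmxr trmxK (dotC (T *m x)).
  by ring.
have Spd x : x != 0 -> 0 < dot x (S *m x) by move=> /Tnd; rewrite SE; lra.
have [a a0 Ha] := posdef_lower_bound ST Spd.
have [K K0 HK] := quadratic_form_bound (B^T *m invmx S *m B).
(* By [posdef_young], half of the dissipation [dot x (S *m x)] absorbs the cross term with [B *m v];
   the other half leaves [a / 2]. *)
exists (a / 2), (2 * K); split; [lra|lra|move=> x v].
have := posdef_young x (B *m v) ST Spd.
rewrite SE dotDr.
have := HK v; rewrite -!mulmxA dot_mulmxr trmxK.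
have := Ha x; rewrite SE; lra.
Qed.

End DotProduct.

(** * Completing the square with the Riccati equation *)

Section RiccatiIdentity.
Variables (R : realType) (n q p : nat) (T : 'M[R]_n) (B : 'M[R]_(n, q)).
Variables (C : 'M[R]_(p, n)) (Y : 'M[R]_n).

(** The equation, evaluated as a form at [x], trades the drift term for the squares of
    [B^T *m Y *m x] and [C *m x]; the control term is the cross term of the completed square. *)
Lemma riccati_dot (x : 'cV[R]_n) (v : 'cV[R]_q) :
  Y^T = Y -> riccati T B C Y = 0 ->
  2 * dot x (Y *m (T *m x + B *m v)) =
  dot (v + B^T *m Y *m x) (v + B^T *m Y *m x) -
  (dot (C *m x) (C *m x) + dot v v).
Proof.
move=> YT ric; have : dot x (riccati T B C Y *m x) = 0.
  by rewrite ric mul0mx dotr0.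
rewrite /riccati !mulmxDl mulNmx !dotDr dotNr.
rewrite -(mulmxA T^T) [dot x (T^T *m _)]dot_mulmxr trmxK.
rewrite -(mulmxA C^T) [dot x (C^T *m _)]dot_mulmxr trmxK.
have -> : dot x (Y *m B *m B^T *m Y *m x) = dot (B^T *m Y *m x) (B^T *m Y *m x).
  by rewrite -!mulmxA dot_mulmxr YT dot_mulmxr mulmxA.
have -> : dot (T *m x) (Y *m x) = dot x (Y *m T *m x).
  by rewrite dotC dot_mulmxl YT mulmxA.
rewrite mulmxDr !dotDr !dotDl.
have -> : dot x (Y *m (B *m v)) = dot v (B^T *m Y *m x).
  by rewrite dot_mulmxr YT dot_mulmxr dotC mulmxA.
rewrite (dotC _ v) !mulmxA; lra.
Qed.

End RiccatiIdentity.

(** * The linear-quadratic problem over real vectors *)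

Section RealTrajectories.
Variable R : realType.
Local Notation mu := (@lebesgue_measure R).

Definition vprimitive n (x0 : 'cV[R]_n) (f x : R -> 'cV[R]_n) :=
  forall i, primitive (x0 i 0) (fun s => f s i 0) (fun s => x s i 0).

(** The scalar product rule summed over pairs of entries; symmetry of [P] merges the two resulting
    halves. *)
Lemma primitive_quadratic n (P : 'M[R]_n) (x0 : 'cV[R]_n) (f x : R -> 'cV[R]_n) :
  P^T = P -> vprimitive x0 f x ->
  primitive (dot x0 (P *m x0)) (fun s => 2 * dot (x s) (P *m f s))
    (fun s => dot (x s) (P *m x s)).
Proof.
move=> PT xf.
have := primitive_sum (index_enum 'I_n) (fun i => primitive_sum (index_enum 'I_n)
  (fun j => primitive_scale (P i j) (primitive_mul (xf i) (xf j)))).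
rewrite -dot_mulmxE; congr primitive; apply/funext => s; last by rewrite dot_mulmxE.
transitivity (dot (f s) (P *m x s) + dot (x s) (P *m f s)).
  rewrite !dot_mulmxE -big_split; apply: eq_bigr => i _; rewrite -big_split.
  by apply: eq_bigr => j _ /=; ring.
rewrite (dotC (f s)) dot_mulmxl PT; ring.
Qed.

(** Serves three times: with [- Y] for the lower bound on the cost, with [Y] for the feedback, and
    with the identity for the decay of the state. *)
Lemma dissipation n (P : 'M[R]_n) (x0 : 'cV[R]_n) (f x : R -> 'cV[R]_n)
    (g : R -> R) (t : R) :
  P^T = P -> vprimitive x0 f x -> 0 <= t -> mu.-integrable `[0, t] (EFin \o g) ->
  (forall s, 0 <= s -> 2 * dot (x s) (P *m f s) <= g s) ->
  dot (x t) (P *m x t) <= dot x0 (P *m x0) + \int[mu]_(s in `[0, t]) g s.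
Proof.
move=> PT xf t0 gi fg; have [i ->] := primitive_quadratic PT xf t0.
rewrite lerD2l; apply: le_Rintegral => // s /=.
by rewrite in_itv/= => /andP[s0 _]; exact: fg.
Qed.

Lemma quadratic_continuous n (P : 'M[R]_n) (x0 : 'cV[R]_n) (f x : R -> 'cV[R]_n) t :
  P^T = P -> vprimitive x0 f x -> 0 <= t ->
  {within `[0, t], continuous (fun s => dot (x s) (P *m x s))}.
Proof. by move=> PT xf; exact: primitive_continuous (primitive_quadratic PT xf). Qed.

Lemma dot_mulmx2 m n (C : 'M[R]_(m, n)) x : dot (C *m x) (C *m x) = dot x (C^T *m C *m x).
Proof. by rewrite dot_mulmxl mulmxA. Qed.

Lemma trmx_mulmx_tr m n (C : 'M[R]_(m, n)) : (C^T *m C)^T = C^T *m C.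
Proof. by rewrite trmx_mul trmxK. Qed.

(** * Cost compared with the value of a given Riccati solution *)

Section LQ.
Variables (n q p : nat) (T : 'M[R]_n) (B : 'M[R]_(n, q)) (C : 'M[R]_(p, n)).
Variables (Y : 'M[R]_n).
Hypothesis Ypsd : psd Y.
Hypothesis Yric : riccati T B C Y = 0.

Lemma psd_dot_ge0 (x : 'cV[R]_n) : 0 <= dot x (Y *m x).
Proof. by have [_ /(_ x)] := Ypsd; rewrite /dot mulmxA. Qed.

Definition running_cost (x : 'cV[R]_n) (v : 'cV[R]_q) : R :=
  dot (C *m x) (C *m x) + dot v v.

Lemma running_cost_ge0 x v : 0 <= running_cost x v.
Proof. by rewrite addr_ge0 ?dot_ge0. Qed.

Lemma measurable_running_cost x0 f x (v : R -> 'cV[R]_q) : vprimitive x0 f x ->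
  (forall i, measurable_fun `[(0 : R), +oo[ (fun s => v s i 0)) ->
  measurable_fun `[(0 : R), +oo[ (fun s => running_cost (x s) (v s)).
Proof.
move=> xf mv; apply: measurable_funD.
  apply: measurable_fun_itvcy => t t0; apply: continuous_itv_measurable.
  rewrite (_ : (fun s => _) = (fun s => dot (x s) (C^T *m C *m x s))).
    exact: quadratic_continuous (trmx_mulmx_tr C) xf t0.
  by apply/funext => s; rewrite dot_mulmx2.
rewrite (_ : (fun s => _) = (fun s => \sum_i v s i 0 * v s i 0)).
  by apply: measurable_sum => i; apply: measurable_funM.
by apply/funext => s; rewrite dotE.
Qed.

Lemma cost_ge_value x0 (x : R -> 'cV[R]_n) (v : R -> 'cV[R]_q) :
  (forall z : 'cV[R]_n, z != 0 -> dot z (T *m z) < 0) ->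
  (forall i, measurable_fun `[(0 : R), +oo[ (fun s => v s i 0)) ->
  vprimitive x0 (fun s => T *m x s + B *m v s) x ->
  ((dot x0 (Y *m x0))%:E <=
    \int[mu]_(s in `[0%R, +oo[) (running_cost (x s) (v s))%:E)%E.
Proof.
move=> Tnd mv xf; have [YT _] := Ypsd.
rewrite leNgt; apply/negP => Jlt.
set J := (\int[mu]_(s in _) _)%E in Jlt.
have J0 : (0 <= J)%E.
  by apply: integral_ge0 => s _; rewrite lee_fin running_cost_ge0.
have Jfin : J \is a fin_num by rewrite ge0_fin_numE// (lt_trans Jlt)// ltry.
rewrite -(fineK Jfin) lte_fin in Jlt.
set j := fine J in Jlt.
have g0 s : 0 <= s -> 0 <= running_cost (x s) (v s).
  by move=> _; exact: running_cost_ge0.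
have mg := measurable_running_cost xf mv.
have gj t (t0 : 0 <= t) := @Rintegral_le_itvcy _ _ t j t0 g0 mg.
have {}gj t : 0 <= t ->
    mu.-integrable `[0, t] (EFin \o (fun s => running_cost (x s) (v s))) /\
    \int[mu]_(s in `[0, t]) running_cost (x s) (v s) <= j.
  by move=> t0; apply: gj => //; rewrite /j fineK.
set e := dot x0 (Y *m x0) - j.
have e0 : 0 < e by rewrite subr_gt0.
(* The form of [Y] drops by at most the cost spent so far, which is at most [j]; the gap [e] always
   remains. *)
have xY t : 0 <= t -> e <= dot (x t) (Y *m x t).
  move=> t0; have [gi gle] := gj _ t0.
  have NYT : (- Y)^T = - Y by rewrite linearN/= YT.
  have := dissipation NYT xf t0 gi.
  rewrite !mulNmx !dotNr => H; rewrite /e.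
  suff : - dot (x t) (Y *m x t) <= - dot x0 (Y *m x0) + j by lra.
  apply: (le_trans (H _)); last by rewrite lerD2l.
  move=> s _; rewrite mulNmx dotNr mulrN (riccati_dot _ _ YT Yric) opprB gerBl.
  exact: dot_ge0.
have [L L0 HL] := quadratic_form_bound Y.
have [a [K [a0 K0 HaK]]] := negdef_energy B Tnd.
(* As the form of [Y] stays above [e], [dot (x s) (x s)] is at least [e / L], so the damping term of
   [negdef_energy] is at most [- d]. *)
pose d := a * (e / L).
have d0 : 0 < d by rewrite mulr_gt0 ?divr_gt0.
(* A time at which the estimate gives [dot (x t) (x t) <= -1]. *)
pose t := (dot x0 x0 + K * j + 1) / d.
have j0 : 0 <= j by rewrite fine_ge0.
have t0 : 0 <= t.
  by rewrite divr_ge0 ?(ltW d0)// !addr_ge0 ?dot_ge0// mulr_ge0// ltW.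
have [gi gle] := gj _ t0.
have ci : mu.-integrable `[0, t] (EFin \o cst (- d)).
  apply: continuous_compact_integrable; first exact: segment_compact.
  by apply: continuous_subspaceT => ?; exact: cvg_cst.
have Kgi : mu.-integrable `[0, t] (EFin \o (fun s => K * running_cost (x s) (v s))).
  by apply: (eq_integrable _ _ _ _ (integrableZl _ K gi)) => // s _ /=; rewrite EFinM.
have hi : mu.-integrable `[0, t]
    (EFin \o (fun s => - d + K * running_cost (x s) (v s))).
  by apply: (eq_integrable _ _ _ _ (integrableD _ ci Kgi)) => // s _ /=; rewrite EFinD.
have dt : d * t = dot x0 x0 + K * j + 1 by rewrite /t mulrC divfK// gt_eqF.
have tE : fine (@lebesgue_measure R `[0, t]) = t.
  rewrite lebesgue_measure_itv/= lte_fin; have [t1|t1] := ltP 0 t.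
    by rewrite /= subr0.
  by apply/eqP; rewrite eq_le t0 t1.
have dE : \int[mu]_(s in `[0, t]) (- d) = - d * t.
  by rewrite Rintegral_cst//; congr (_ * _); exact: tE.
have := dissipation (trmx1 _ _) xf t0 hi.
rewrite !mul1mx RintegralD// RintegralZl// dE => H; have {}H := H _.
have := dot_ge0 (x t).
suff : dot (x t) (x t) <= dot x0 x0 +
    (- d * t + K * \int[mu]_(s in `[0, t]) running_cost (x s) (v s)).
  have := ler_wpM2l (ltW K0) gle; lra.
apply: H => s s0; rewrite mul1mx (le_trans (HaK _ _))//.
apply: lerD; last by rewrite ler_wpM2l ?(ltW K0)// lerDr dot_ge0.
rewrite mulNr lerN2 ler_wpM2l ?(ltW a0)// ler_pdivrMr// mulrC.
exact: le_trans (xY _ s0) (HL _).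
Qed.

(** The feedback cancels the square in [riccati_dot], so the cost up to [t] is the initial form
    minus the final one, which is nonnegative. *)
Lemma closed_loop_cost_le_value x0 (x : R -> 'cV[R]_n) :
  let v s := - (B^T *m Y *m x s) in
  vprimitive x0 (fun s => T *m x s + B *m v s) x ->
  (\int[mu]_(s in `[0%R, +oo[) (running_cost (x s) (v s))%:E
    <= (dot x0 (Y *m x0))%:E)%E.
Proof.
move=> v xf; have [YT _] := Ypsd.
have vE s : dot (v s) (v s) = dot (x s) ((B^T *m Y)^T *m (B^T *m Y) *m x s).
  by rewrite dotNr dotNl opprK dot_mulmx2.
have cg t : 0 <= t -> {within `[0, t], continuous (fun s => running_cost (x s) (v s))}.
  move=> t0.
  rewrite (_ : (fun s => _) = (fun s =>
      dot (x s) ((C^T *m C + (B^T *m Y)^T *m (B^T *m Y)) *m x s))).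
    by apply: quadratic_continuous xf t0; rewrite linearD/= !trmx_mulmx_tr.
  by apply/funext => s; rewrite /running_cost vE dot_mulmx2 mulmxDl dotDr.
apply: ge0_integral_itvcy_le.
- by move=> s _; exact: running_cost_ge0.
- by apply: measurable_fun_itvcy => t t0; apply: continuous_itv_measurable; exact: cg.
move=> t t0.
have gi : mu.-integrable `[0, t] (EFin \o (fun s => running_cost (x s) (v s))).
  by apply: continuous_compact_integrable (cg _ t0); exact: segment_compact.
have Ngi : mu.-integrable `[0, t] (EFin \o (fun s => -1 * running_cost (x s) (v s))).
  by apply: (eq_integrable _ _ _ _ (integrableZl _ (-1) gi)) => // s _ /=; rewrite EFinM.
rewrite -[leLHS]fineK; last exact: integrable_fin_num gi.
rewrite lee_fin -/(Rintegral mu `[0, t] (fun s => running_cost (x s) (v s))).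
have := dissipation YT xf t0 Ngi.
rewrite RintegralZl// => H.
have := psd_dot_ge0 (x t).
suff : dot (x t) (Y *m x t) <= dot x0 (Y *m x0) +
    -1 * \int[mu]_(s in `[0, t]) running_cost (x s) (v s) by lra.
apply: H => s s0; rewrite (riccati_dot _ _ YT Yric).
by rewrite /v addNr dotr0 sub0r mulN1r.
Qed.

End LQ.
End RealTrajectories.

(** * The matrix exponential *)

Section MatrixExponential.
Variable R : realType.
Local Notation mu := (@lebesgue_measure R).

(** Comparison with the scalar exponential series at [b * |x|]. *)
Lemma cvg_pseries_exp_bound (c : R^nat) (b : R) : 
  (forall k, `|c k| <= b ^+ k / k`!%:R) -> forall x : R, cvgn (pseries c x).
Proof.
move=> cb x; apply: normed_cvg.
(* The bound on [c 1] forces this sign. *)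
have b0 : 0 <= b.
  by have := cb 1%N; rewrite expr1 divr1; apply: le_trans.
apply: (@series_le_cvg _ _ (exp_coeff (b * `|x|))) => [k|k|k|].
- exact: normr_ge0.
- by rewrite /exp_coeff /= mulr_ge0 ?exprn_ge0 ?mulr_ge0.
- rewrite /= normrM normrX /exp_coeff /= exprMn mulrAC ler_wpM2r ?exprn_ge0//.
- exact: is_cvg_series_exp_coeff.
Qed.

(** The base dominates every absolute row sum of [M], so each further factor [M] enlarges the
    entries at most by it. *)
Lemma normr_exprmx n (M : 'M[R]_n) k i j :
  `|(M ^+ k) i j| <= (1 + \sum_a \sum_b `|M a b|) ^+ k.
Proof.
set b := 1 + _.
have sb a : \sum_l `|M a l| <= b.
  rewrite /b [X in 1 + X](bigD1 a)//= addrCA lerDl addr_ge0//.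
  by do 2! apply: sumr_ge0 => ? _.
have b0 : 0 <= b by apply: le_trans (sb i); apply: sumr_ge0.
elim: k i j => [|k IHk] i j.
  rewrite !expr0 mxE; case: (i == j); by rewrite ?normr1 ?normr0.
rewrite exprS mxE (le_trans (ler_norm_sum _ _ _))//.
apply: (@le_trans _ _ (\sum_l `|M i l| * b ^+ k)).
  by apply: ler_sum => l _; rewrite normrM ler_wpM2l.
by rewrite -mulr_suml exprS ler_wpM2r ?exprn_ge0.
Qed.

(** Taylor coefficients of one entry of the exponential as a function of time, so that scalar power
    series apply entry by entry. *)
Definition expmx_coeff n (M : 'M[R]_n) i j (k : nat) : R := k`!%:R^-1 * (M ^+ k) i j.

Lemma expmx_coeff_bound n (M : 'M[R]_n) i j k :
  `|expmx_coeff M i j k| <= (1 + \sum_a \sum_b `|M a b|) ^+ k / k`!%:R.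
Proof.
rewrite /expmx_coeff normrM ger0_norm ?invr_ge0// mulrC ler_wpM2r ?invr_ge0//.
exact: normr_exprmx.
Qed.

Lemma expmxE n (M : 'M[R]_n) i j t :
  expmx (t *: M) i j = limn (pseries (expmx_coeff M i j) t).
Proof.
rewrite mxE; congr (limn (series _)); apply/funext => k.
rewrite mxE /= /expmx_coeff -mulrA; congr (_ * _).
elim: k i j => [|k IHk] i j; first by rewrite !expr0 mulr1.
rewrite !exprS !mxE mulr_suml; apply: eq_bigr => l _.
rewrite IHk mxE; ring.
Qed.

(** The derivative of the exponential is [M] times it, at the level of coefficients. *)
Lemma pseries_diffs_expmx n (M : 'M[R]_n) i j :
  pseries_diffs (expmx_coeff M i j) = (fun k => \sum_l M i l * expmx_coeff M l j k).
Proof.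
apply/funext => k; rewrite /pseries_diffs /expmx_coeff exprS mxE !mulr_sumr.
apply: eq_bigr => l _; rewrite factS natrM invfM !mulrA mulfV ?pnatr_eq0//.
by rewrite mul1r mulrAC mulrC mulrA [M i l * _]mulrC.
Qed.

Lemma cvg_pseries_expmx n (M : 'M[R]_n) i j t : cvgn (pseries (expmx_coeff M i j) t).
Proof. exact: cvg_pseries_exp_bound (expmx_coeff_bound M i j) t. Qed.

Lemma pseries_expmx_sum n (M : 'M[R]_n) (c : 'I_n -> R) j t :
  pseries (fun k => \sum_l c l * expmx_coeff M l j k) t @ \oo -->
  \sum_l c l * expmx (t *: M) l j.
Proof.
have -> : pseries (fun k => \sum_l c l * expmx_coeff M l j k) t =
    (fun N => \sum_l c l * pseries (expmx_coeff M l j) t N).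
  apply/funext => N; rewrite /pseries /series /=.
  under eq_bigr do rewrite mulr_suml.
  rewrite exchange_big; apply: eq_bigr => l _; rewrite mulr_sumr.
  by apply: eq_bigr => k _; rewrite mulrA.
apply: cvg_big => [|l _]; first exact: add_continuous.
apply: cvgMl_tmp; rewrite expmxE.
exact: cvg_pseries_expmx.
Qed.

Lemma expmx0 n (M : 'M[R]_n) : expmx (0 *: M) = 1%:M.
Proof.
apply/matrixP => i j; rewrite expmxE; apply/cvg_lim => //.
(* Since [0 ^+ 0 = 1], only the term of index 0 survives; partial sums are constant once
   nonempty. *)
apply: cvg_near_cst; exists 1%N => // N /= N0.
rewrite /pseries /series /= -(prednK N0) big_nat_recl// big1 ?addr0.
  by rewrite /expmx_coeff !expr0 fact0 invr1 mul1r mulr1.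
by move=> k _; rewrite expr0n mulr0.
Qed.

Lemma is_derive_expmx n (M : 'M[R]_n) i j t :
  is_derive t (1 : R) (fun s => expmx (s *: M) i j) ((M *m expmx (t *: M)) i j).
Proof.
have -> : (fun s => expmx (s *: M) i j) = (fun s => limn (pseries (expmx_coeff M i j) s)).
  by apply/funext => s; rewrite expmxE.
have dE (c : 'I_n -> R) s : cvgn (pseries (fun k => \sum_l c l * expmx_coeff M l j k) s).
  by apply/cvg_ex; eexists; exact: pseries_expmx_sum.
have -> : (M *m expmx (t *: M)) i j = limn (pseries (pseries_diffs (expmx_coeff M i j)) t).
  rewrite pseries_diffs_expmx mxE; apply/esym/cvg_lim => //.
  exact: pseries_expmx_sum.
(* Termwise differentiation asks that the series and its first two formal derivatives converge at a
   point of modulus larger than [|t|]. *)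
apply: (@pseries_snd_diffs _ _ (`|t| + 1)).
- exact: cvg_pseries_expmx.
- by rewrite pseries_diffs_expmx.
(* Differentiating twice weights the coefficients by a row of the square of [M]. *)
- have -> : pseries_diffs (pseries_diffs (expmx_coeff M i j)) =
      (fun k => \sum_l (\sum_m M i m * M m l) * expmx_coeff M l j k).
    rewrite pseries_diffs_expmx; apply/funext => k; rewrite /pseries_diffs mulr_sumr.
    under [RHS]eq_bigr do rewrite mulr_suml.
    rewrite exchange_big; apply: eq_bigr => m _ /=.
    rewrite mulrCA -/(pseries_diffs (expmx_coeff M m j) k) pseries_diffs_expmx mulr_sumr.
    by apply: eq_bigr => l _; rewrite mulrA.
  exact: dE.
- by rewrite [ltRHS]ger0_norm ?addr_ge0// ltrDl.
Qed.

Lemma continuous_expmx n (M : 'M[R]_n) i j : continuous (fun t : R => expmx (t *: M) i j).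
Proof.
move=> t; apply: differentiable_continuous; apply/derivable1_diffP.
by have [] := is_derive_expmx M i j t.
Qed.

End MatrixExponential.

(** * The exponential as a solution of the linear system *)

Section LinearFlow.
Variable R : realType.
Local Notation mu := (@lebesgue_measure R).

Lemma primitive_derive (F f : R -> R) :
  (forall t, is_derive t (1 : R) F (f t)) -> continuous f -> primitive (F 0) f F.
Proof.
move=> dF cf t t0.
have cf0t : {within `[0, t], continuous f} by exact: continuous_subspaceT.
split; first by apply: continuous_compact_integrable cf0t; exact: segment_compact.
have cF s : {for s, continuous F}.
  by apply: differentiable_continuous; apply/derivable1_diffP; have [] := dF s.
(* The fundamental theorem of calculus is for a nondegenerate interval; at [t = 0] the integral is
   over a point. *)
move: t0; rewrite le_eqVlt => /predU1P[<-|t0].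
  by rewrite set_itv1 Rintegral_set1 addr0.
have /= H := @continuous_FTC2 R f F 0 t t0 cf0t.
rewrite /Rintegral H.
- by rewrite /= subrKC.
- split; first by move=> s _; have [] := dF s.
  + exact: (cvg_at_right_filter (cF 0)).
  + exact: (cvg_at_left_filter (cF t)).
- by move=> s _; rewrite derive1E; have [_ ->] := dF s.
Qed.

Lemma vprimitive_expmx n (M : 'M[R]_n) (a : 'cV[R]_n) :
  vprimitive a (fun s => M *m (expmx (s *: M) *m a)) (fun s => expmx (s *: M) *m a).
Proof.
move=> i.
have cM j : continuous (fun t : R => (M *m expmx (t *: M)) i j).
  rewrite (_ : (fun t => _) = (fun t => \sum_l M i l * expmx (t *: M) l j)); last first.
    by apply/funext => t; rewrite mxE.
  move=> t; apply: cvg_big => [|l _]; first exact: add_continuous.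
  by apply: cvgMl_tmp; exact: continuous_expmx.
have := primitive_sum (index_enum 'I_n)
  (fun j => primitive_scale (a j 0) (primitive_derive (is_derive_expmx M i j) (cM j))).
have -> : \sum_j a j 0 * expmx (0 *: M) i j = a i 0.
  by rewrite -[in RHS](mul1mx a) -(expmx0 M) mxE; apply: eq_bigr => j _; rewrite mulrC.
rewrite (_ : (fun s => \sum_j a j 0 * (M *m expmx (s *: M)) i j) =
   (fun s => (M *m (expmx (s *: M) *m a)) i 0)); last first.
  by apply/funext => s; rewrite mulmxA mxE; apply: eq_bigr => j _; rewrite mulrC.
rewrite (_ : (fun s => \sum_j a j 0 * expmx (s *: M) i j) =
   (fun s => (expmx (s *: M) *m a) i 0)); last first.
  by apply/funext => s; rewrite mxE; apply: eq_bigr => j _; rewrite mulrC.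
by [].
Qed.

(** * Uniqueness of the positive semidefinite solution *)

Section RiccatiUniqueness.
Variables (n q p : nat) (T : 'M[R]_n) (B : 'M[R]_(n, q)) (C : 'M[R]_(p, n)).
Hypothesis Tnd : forall z : 'cV[R]_n, z != 0 -> dot z (T *m z) < 0.

Lemma vprimitive_closed_loop (Y : 'M[R]_n) a :
  let x s := expmx (s *: (T - B *m B^T *m Y)) *m a in
  vprimitive a (fun s => T *m x s + B *m - (B^T *m Y *m x s)) x.
Proof.
move=> x; have := vprimitive_expmx (T - B *m B^T *m Y) a.
congr vprimitive; apply/funext => s.
by rewrite mulmxBl mulmxN !mulmxA.
Qed.

Lemma measurable_vprimitive (m : nat) (K : 'M[R]_(m, n)) x0 f x i : vprimitive x0 f x ->
  measurable_fun `[(0 : R), +oo[ (fun s => (K *m x s) i 0).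
Proof.
move=> xf.
rewrite (_ : (fun s => _) = (fun s => \sum_j K i j * x s j 0)); last first.
  by apply/funext => s; rewrite mxE.
apply: measurable_sum => j; apply: measurable_funM => //.
apply: measurable_fun_itvcy => t t0; apply: continuous_itv_measurable.
exact: primitive_continuous (xf j) t0.
Qed.

(** The feedback built from [Y'] costs at most the value of [Y'], and, like any control, at least
    the value of [Y]. *)
Lemma value_le (Y Y' : 'M[R]_n) a : psd Y -> riccati T B C Y = 0 ->
  psd Y' -> riccati T B C Y' = 0 -> dot a (Y *m a) <= dot a (Y' *m a).
Proof.
move=> Yp Yr Yp' Yr'; rewrite -lee_fin.
have xf := vprimitive_closed_loop Y' a.
apply: le_trans (closed_loop_cost_le_value Yp' Yr' xf).
apply: (cost_ge_value Yp Yr Tnd _ xf) => i.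
have := measurable_vprimitive (- (B^T *m Y')) i xf.
by congr measurable_fun; apply/funext => s; rewrite mulNmx.
Qed.

Lemma riccati_unique (Y Y' : 'M[R]_n) : psd Y -> riccati T B C Y = 0 ->
  psd Y' -> riccati T B C Y' = 0 -> Y' = Y.
Proof.
move=> Yp Yr Yp' Yr'; apply: trmx_eq_dot; [by case: Yp'|by case: Yp|move=> a].
by apply/eqP; rewrite eq_le !value_le.
Qed.

End RiccatiUniqueness.
End LinearFlow.

(** * Real and imaginary parts *)

Section ComplexVectors.
Variable R : realType.
Local Notation Re := (@complex.Re R).
Local Notation Im := (@complex.Im R).
Local Notation rpart := (map_mx Re).
Local Notation ipart := (map_mx Im).
Local Open Scope sesquilinear_scope.

Lemma cReD : {morph Re : a b / a + b}. Proof. by move=> [? ?] [? ?]. Qed.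
Lemma cImD : {morph Im : a b / a + b}. Proof. by move=> [? ?] [? ?]. Qed.
Lemma cReM (r : R) z : Re (r%:C%C * z) = r * Re z.
Proof. by case: z => a b /=; rewrite mul0r subr0. Qed.
Lemma cImM (r : R) z : Im (r%:C%C * z) = r * Im z.
Proof. by case: z => a b /=; rewrite mul0r addr0. Qed.

Lemma rpart_cmx m n (M : 'M[R]_(m, n)) (x : 'cV[R[i]]_n) :
  rpart (cmx M *m x) = M *m rpart x.
Proof.
apply/colP => i; rewrite !mxE (big_morph _ cReD (erefl : Re 0 = 0)).
by apply: eq_bigr => j _; rewrite !mxE cReM.
Qed.

Lemma ipart_cmx m n (M : 'M[R]_(m, n)) (x : 'cV[R[i]]_n) :
  ipart (cmx M *m x) = M *m ipart x.
Proof.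
apply/colP => i; rewrite !mxE (big_morph _ cImD (erefl : Im 0 = 0)).
by apply: eq_bigr => j _; rewrite !mxE cImM.
Qed.

Lemma Re_hermitian_square n (x : 'cV[R[i]]_n) :
  Re ((x ^t* *m x) 0 0) = dot (rpart x) (rpart x) + dot (ipart x) (ipart x).
Proof.
rewrite !dotE mxE (big_morph _ cReD (erefl : Re 0 = 0)) -big_split.
apply: eq_bigr => i _; rewrite !mxE /=.
by case: (x i 0) => a b /=; rewrite mulNr opprK.
Qed.

Lemma Re_cost_integrand n q p (C : 'M[R]_(p, n)) (x : 'cV[R[i]]_n) (u : 'cV[R[i]]_q) :
  Re ((x ^t* *m (cmx C) ^t* *m cmx C *m x + u ^t* *m u) 0 0) =
  running_cost C (rpart x) (rpart u) + running_cost C (ipart x) (ipart u).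
Proof.
have -> : x ^t* *m (cmx C) ^t* *m cmx C *m x = (cmx C *m x) ^t* *m (cmx C *m x).
  by rewrite trmx_mul map_mxM !mulmxA.
rewrite mxE cReD !Re_hermitian_square rpart_cmx ipart_cmx /running_cost; ring.
Qed.

(** The coefficients being real, the complex system is two uncoupled copies of the real one. *)
Lemma trajectoryP n q (T : 'M[R]_n) (B : 'M[R]_(n, q)) x0 (u : R -> 'cV[R[i]]_q) x :
  trajectory T B x0 u x <->
  vprimitive (rpart x0) (fun s => T *m rpart (x s) + B *m rpart (u s))
    (fun s => rpart (x s)) /\
  vprimitive (ipart x0) (fun s => T *m ipart (x s) + B *m ipart (u s))
    (fun s => ipart (x s)).
Proof.
have rE i : (fun s => (T *m rpart (x s) + B *m rpart (u s)) i 0) =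
    (fun s => Re ((cmx T *m x s + cmx B *m u s) i 0)).
  by apply/funext => s; rewrite -!rpart_cmx !mxE cReD.
have iE i : (fun s => (T *m ipart (x s) + B *m ipart (u s)) i 0) =
    (fun s => Im ((cmx T *m x s + cmx B *m u s) i 0)).
  by apply/funext => s; rewrite -!ipart_cmx !mxE cImD.
split=> [xu|[xr xi] rhs t t0].
  split=> i t t0; have [/(_ i)[ri ii] xt] := xu t t0.
    by rewrite rE; split => //; rewrite mxE xt !mxE cReD.
  by rewrite iE; split => //; rewrite mxE xt !mxE cImD.
split.
  by move=> i; have [+ _] := xr i t t0; have [+ _] := xi i t t0; rewrite rE iE.
apply/colP => i; have [_] := xr i t t0; have [_] := xi i t t0.
rewrite rE iE !mxE; case: (x t i 0) => a b /= -> ->.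
by case: (x0 i 0).
Qed.

(** Integrals of nonnegative measurable functions add even when infinite; the primitives provide
    measurability of the state. *)
Lemma costE n q p (C : 'M[R]_(p, n)) x0r x0i fr fi
    (u : R -> 'cV[R[i]]_q) (x : R -> 'cV[R[i]]_n) :
  vprimitive x0r fr (fun s => rpart (x s)) ->
  vprimitive x0i fi (fun s => ipart (x s)) ->
  vmeasurable `[0, +oo[ u ->
  (cost C u x =
   \int[@lebesgue_measure R]_(s in `[0%R, +oo[)
     (running_cost C (rpart (x s)) (rpart (u s)))%:E +
   \int[@lebesgue_measure R]_(s in `[0%R, +oo[)
     (running_cost C (ipart (x s)) (ipart (u s)))%:E)%E.
Proof.
move=> xr xi um; rewrite /cost.
under eq_integral do rewrite Re_cost_integrand EFinD.
rewrite ge0_integralD//.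
- by move=> s _; rewrite lee_fin running_cost_ge0.
- apply/measurable_EFinP; apply: (measurable_running_cost C xr) => i.
  by have := (um i).1; congr measurable_fun; apply/funext => s; rewrite mxE.
- by move=> s _; rewrite lee_fin running_cost_ge0.
- apply/measurable_EFinP; apply: (measurable_running_cost C xi) => i.
  by have := (um i).2; congr measurable_fun; apply/funext => s; rewrite mxE.
Qed.

(** [eigenvalue] speaks of row vectors; this gives access to column eigenvectors. *)
Lemma eigenvalue_trmx (F : fieldType) n (M : 'M[F]_n) a : eigenvalue M^T a = eigenvalue M a.
Proof.
rewrite /eigenvalue /eigenspace !kermx_eq0 !row_free_unit -[in LHS]unitmx_tr.
by rewrite linearB/= trmxK tr_scalar_mx.
Qed.

Lemma eigenvalue_real_parts n (M : 'M[R]_n) z : eigenvalue (cmx M) z ->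
  exists a b : 'cV[R]_n, [/\ (a != 0) || (b != 0),
    M *m a = Re z *: a - Im z *: b & M *m b = Re z *: b + Im z *: a].
Proof.
rewrite -eigenvalue_trmx => /eigenvalueP[v vM v0].
have Mv : cmx M *m v^T = z *: v^T by rewrite -[cmx M]trmxK -trmx_mul vM linearZ.
exists (rpart v^T), (ipart v^T); split.
- apply: contraNT v0; rewrite negb_or !negbK => /andP[/eqP r0 /eqP i0].
  apply/eqP/rowP => i; move/colP/(_ i) : r0; move/colP/(_ i) : i0; rewrite !mxE.
  by case: (v 0 i) => a b /= -> ->.
- rewrite -rpart_cmx Mv; apply/colP => i; rewrite !mxE.
  by case: z {vM Mv} => c d; case: (v 0 i).
- rewrite -ipart_cmx Mv; apply/colP => i; rewrite !mxE.
  by case: z {vM Mv} => c d; case: (v 0 i).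
Qed.

(** Lyapunov argument: if the real part of [z] were nonnegative, the energy identity would force
    [B^T *m Y] to kill the eigenvector, which would then be one of [T] for the same [z], against
    negative definiteness. *)
Lemma closed_loop_stable n q p (T : 'M[R]_n) (B : 'M[R]_(n, q)) (C : 'M[R]_(p, n)) Y :
  (forall z : 'cV[R]_n, z != 0 -> dot z (T *m z) < 0) ->
  psd Y -> riccati T B C Y = 0 -> stable (T - B *m B^T *m Y).
Proof.
move=> Tnd Yp Yr z /eigenvalue_real_parts[a [b [ab Ma Mb]]].
have [YT _] := Yp.
rewrite ltNge; apply/negP => z0.
have energy c : 2 * dot c (Y *m ((T - B *m B^T *m Y) *m c)) =
    - (dot (C *m c) (C *m c) + dot (B^T *m Y *m c) (B^T *m Y *m c)).
  have := riccati_dot c (- (B^T *m Y *m c)) YT Yr.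
  rewrite addNr dotr0 sub0r dotNr dotNl opprK => <-.
  by rewrite mulmxBl mulmxN !mulmxA.
(* Makes the terms in the imaginary part of [z] cancel when the identities for [a] and [b] are
   added. *)
have Yab : dot a (Y *m b) = dot b (Y *m a) by rewrite dotC dot_mulmxl YT.
have := energy a; have := energy b.
rewrite Ma Mb mulmxBr mulmxDr -!scalemxAr !dotDr dotNr !dotZr Yab => Eb Ea.
have qa := psd_dot_ge0 Yp a; have qb := psd_dot_ge0 Yp b.
have zqa := mulr_ge0 z0 qa; have zqb := mulr_ge0 z0 qb.
have ca := dot_ge0 (C *m a); have cb := dot_ge0 (C *m b).
have ua := dot_ge0 (B^T *m Y *m a); have ub := dot_ge0 (B^T *m Y *m b).
have ua0 : B^T *m Y *m a = 0 by apply/eqP; rewrite -dot_eq0; apply/eqP; lra.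
have ub0 : B^T *m Y *m b = 0 by apply/eqP; rewrite -dot_eq0; apply/eqP; lra.
have Ta : T *m a = complex.Re z *: a - complex.Im z *: b.
  by rewrite -Ma mulmxBl -!mulmxA [B^T *m _]mulmxA ua0 mulmx0 subr0.
have Tb : T *m b = complex.Re z *: b + complex.Im z *: a.
  by rewrite -Mb mulmxBl -!mulmxA [B^T *m _]mulmxA ub0 mulmx0 subr0.
have : 0 <= dot a (T *m a) + dot b (T *m b).
  rewrite Ta Tb !dotDr dotNr !dotZr (dotC b a).
  have := mulr_ge0 z0 (dot_ge0 a); have := mulr_ge0 z0 (dot_ge0 b); lra.
have Tle c : dot c (T *m c) <= 0.
  have [->|/Tnd/ltW//] := eqVneq c 0; by rewrite mulmx0 dotr0.
by have := Tle a; have := Tle b; case/orP: ab => /Tnd; lra.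
Qed.

(** At a real vector the point of the field of values is the real Rayleigh quotient. *)
Lemma passive_dot n (A : 'M[R]_n) (z : 'cV[R]_n) :
  passive A -> z != 0 -> dot z (A *m z) < 0.
Proof.
move=> pA z0.
have zt : (cmx z) ^t* = cmx z^T.
  by apply/matrixP => i j; rewrite !mxE conj_Creal// complex_real.
have := pA ((cmx z ^t* *m cmx A *m cmx z) 0 0 / (cmx z ^t* *m cmx z) 0 0).
rewrite zt /cmx -!map_mxM !mxE -fmorphV -rmorphM /= => H.
have {}H : dot z (A *m z) / dot z z < 0.
  rewrite /dot mulmxA !mxE; apply: H; exists (cmx z).
    by apply: contra z0 => /eqP zE; apply/eqP/colP => i; move/colP/(_ i) : zE;
      rewrite !mxE => /complexI.
  by rewrite zt /cmx -!map_mxM !mxE -fmorphV -rmorphM.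
by move: H; rewrite ltr_pdivrMr ?mul0r// dot_gt0.
Qed.

(** The compressed form at [z] is the form of [A] at [V *m z], nonzero since [V] has the left
    inverse [V^T]. *)
Lemma passive_galerkin n d (A : 'M[R]_n) (V : 'M[R]_(n, d)) (z : 'cV[R]_d) :
  passive A -> V^T *m V = 1%:M -> z != 0 -> dot z (V^T *m A *m V *m z) < 0.
Proof.
move=> pA VV z0; rewrite -!mulmxA dot_mulmxr trmxK; apply: passive_dot => //.
by apply: contra z0 => /eqP Vz0; rewrite -[z]mul1mx -VV -mulmxA Vz0 mulmx0.
Qed.

End ComplexVectors.

Theorem corollary3p2 (R : realType) (n q p d : nat)
    (A : 'M[R]_n) (B : 'M[R]_(n, q)) (C : 'M[R]_(p, n)) (x0 : 'cV[R[i]]_n)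
    (V : 'M[R]_(n, d)) (Y : 'M[R]_d) :
  passive A ->
  V^T *m V = 1%:M ->
  let Tk := V^T *m A *m V in
  let Bk := V^T *m B in
  let Ck := C *m V in
  psd Y ->
  riccati Tk Bk Ck Y = 0 ->
  let xhat0 := cmx V^T *m x0 in
  let closed_loop := Tk - Bk *m Bk^T *m Y in
  let xopt := fun t : R => cmx (expmx (t *: closed_loop)) *m xhat0 in
  let uopt := fun t : R => - (cmx (Bk^T *m Y) *m xopt t) in
  [/\ forall Y' : 'M[R]_d, psd Y' -> riccati Tk Bk Ck Y' = 0 -> Y' = Y,
      stable closed_loop,
      admissible uopt,
      trajectory Tk Bk xhat0 uopt xopt
    & ereal_inf (costs Tk Bk Ck xhat0) = cost Ck uopt xopt].
Proof.
move=> pA VV Tk Bk Ck Yp Yr xhat0 closed_loop xopt uopt.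
have Tnd z : z != 0 -> dot z (Tk *m z) < 0 by exact: passive_galerkin.
have [YT _] := Yp.
have ropt s : map_mx (@complex.Re R) (xopt s) =
    expmx (s *: closed_loop) *m map_mx (@complex.Re R) xhat0.
  by rewrite rpart_cmx.
have iopt s : map_mx (@complex.Im R) (xopt s) =
    expmx (s *: closed_loop) *m map_mx (@complex.Im R) xhat0.
  by rewrite ipart_cmx.
have ruopt s : map_mx (@complex.Re R) (uopt s) =
    - (Bk^T *m Y *m map_mx (@complex.Re R) (xopt s)).
  by rewrite -rpart_cmx; apply/colP => i; rewrite !mxE; case: (\sum_j _).
have iuopt s : map_mx (@complex.Im R) (uopt s) =
    - (Bk^T *m Y *m map_mx (@complex.Im R) (xopt s)).
  by rewrite -ipart_cmx; apply/colP => i; rewrite !mxE; case: (\sum_j _).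
have traj : trajectory Tk Bk xhat0 uopt xopt.
  apply/trajectoryP; split.
    have := vprimitive_closed_loop Tk Bk Y (map_mx (@complex.Re R) xhat0).
    by congr vprimitive; apply/funext => s; rewrite ?ruopt ropt.
  have := vprimitive_closed_loop Tk Bk Y (map_mx (@complex.Im R) xhat0).
  by congr vprimitive; apply/funext => s; rewrite ?iuopt iopt.
have /trajectoryP[xr xi] := traj.
have uopt_measurable : vmeasurable `[0, +oo[%classic uopt.
  move=> i; split.
    have := measurable_vprimitive (- (Bk^T *m Y)) i xr.
    congr measurable_fun; apply/funext => s.
    by rewrite mulNmx -ruopt mxE.
  have := measurable_vprimitive (- (Bk^T *m Y)) i xi.
  congr measurable_fun; apply/funext => s.
  by rewrite mulNmx -iuopt mxE.
have uopt_admissible : admissible uopt.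
  split => // t t0.
  (* The squared norm of the feedback is the form of [P] at the real and imaginary parts of the
     state, hence continuous and locally integrable. *)
  pose P := (Bk^T *m Y)^T *m (Bk^T *m Y).
  have PT : P^T = P by exact: trmx_mulmx_tr.
  have ir := continuous_compact_integrable (@segment_compact R 0 t)
    (quadratic_continuous PT xr t0).
  have ii := continuous_compact_integrable (@segment_compact R 0 t)
    (quadratic_continuous PT xi t0).
  rewrite (le_lt_trans _ (integrable_lty _ (integrableD _ ir ii)))//.
  rewrite le_eqVlt; apply/orP; left; apply/eqP; apply: eq_integral => s _ /=.
  by rewrite Re_hermitian_square ruopt iuopt !dotNr !dotNl !opprK !dot_mulmx2 EFinD.
split => //.
- by move=> Y' Yp' Yr'; apply: (riccati_unique Tnd Yp Yr Yp' Yr').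
- exact: closed_loop_stable Tnd Yp Yr.
apply/eqP; rewrite eq_le; apply/andP; split.
  by apply: ereal_inf_lbound; exists uopt, xopt.
apply: le_ereal_inf_tmp => _ [u [x [[um _] /trajectoryP[ur ui] ->]]].
rewrite (costE Ck ur ui um) (costE Ck xr xi uopt_measurable).
(* The middle term is the optimal value: the form of [Y] at both parts of the initial state. *)
apply: (@le_trans _ _ ((dot (map_mx (@complex.Re R) xhat0)
    (Y *m map_mx (@complex.Re R) xhat0))%:E +
  (dot (map_mx (@complex.Im R) xhat0) (Y *m map_mx (@complex.Im R) xhat0))%:E)%E).
  apply: leeD.
    under eq_integral do rewrite ruopt.
    apply: (closed_loop_cost_le_value Yp Yr).
    move: xr; congr vprimitive; apply/funext => s; by rewrite ruopt.
  under eq_integral do rewrite iuopt.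
  apply: (closed_loop_cost_le_value Yp Yr).
  move: xi; congr vprimitive; apply/funext => s; by rewrite iuopt.
apply: leeD; apply: (cost_ge_value Yp Yr Tnd) => // i.
  by have := (um i).1; congr measurable_fun; apply/funext => s; rewrite mxE.
by have := (um i).2; congr measurable_fun; apply/funext => s; rewrite mxE.
Qed.
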